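(* Let $d\ge2$ and $n\ge1$ be integers. For any given $n$-qudit state $|\psi\rangle$ (unit vector in $\mathcal{H}_d^{\otimes n}$), there exists a quantum circuit on $n$ qudits, composed of CINC gates and single-qudit gates, that maps the initial state $|0\rangle^{\otimes n}$ to $|\psi\rangle$ using at most $2\big(\frac{d^n-1}{d-1}-n\big)$ CINC gates. When $d$ is a prime, there is such a circuit composed of SUM gates and single-qudit gates using at most $d\big(\frac{d^n-1}{d-1}-n\big)$ SUM gates.
   Context: $\mathcal{H}_{d}$ is a $d$-dimensional complex Hilbert space with orthonormal (computational) basis $|0\rangle,\dots,|d-1\rangle$ (a qudit). $X_d=|0\rangle\langle d-1|+\sum_{a=0}^{d-2}|a+1\rangle\langle a|$. A CINC gate on $n$ qudits is, for some $i\ne j$ in $\{1,\dots,n\}$, the unitary that on a computational basis vector $|x_1\dots x_n\rangle$ applies $X_d$ to the $j$-th tensor factor if $x_i=d-1$ and acts as the identity otherwise. A SUM gate is, for some $i\neq j$, the unitary that applies $X_d^{x_i}$ to the $j$-th tensor factor of $|x_1\dots x_n\rangle$. A single-qudit gate is an arbitrary unitary acting nontrivially on one tensor factor only (their number is not restricted). No ancillas are used. *)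

(* Defs.v *)
From HB Require Import structures.
From mathcomp Require Import all_boot all_order all_algebra.
From mathcomp Require Import complex reals.

Set Implicit Arguments.
Unset Strict Implicit.
Unset Printing Implicit Defensive.

Import Order.TTheory GRing.Theory Num.Theory.
Local Open Scope ring_scope.

(* Words x_1 ... x_n labelling the computational basis of n qudits. *)
Definition word (d n : nat) := {ffun 'I_n -> 'I_d}.

(* Vectors of the n-fold tensor power of H_d, given by their coordinates in the
   computational basis. *)
Definition qvec (C : numClosedFieldType) (d n : nat) := {ffun word d n -> C^o}.

Definition ket (C : numClosedFieldType) (d n : nat) (x : word d n) :
    qvec C d n :=
  [ffun y => (y == x)%:R].

Definition is_state (C : numClosedFieldType) (d n : nat) (psi : qvec C d n) :
    Prop :=
  \sum_x `|psi x| ^+ 2 = 1.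

Definition set_factor (d n : nat) (x : word d n) (j : 'I_n) (b : 'I_d) :
    word d n :=
  [ffun k => if k == j then b else x k].

(* Matrices act on columns: U |a> = \sum_b U b a |b>.  This is U applied to the
   j-th tensor factor of |x>. *)
Definition act_factor (C : numClosedFieldType) (d n : nat) (j : 'I_n)
    (U : 'M[C]_d) (x : word d n) : qvec C d n :=
  \sum_(b < d) U b (x j) *: (ket C (set_factor x j b) : qvec C d n).

Definition linear_ext (C : numClosedFieldType) (d n : nat)
    (f : word d n -> qvec C d n) (psi : qvec C d n) : qvec C d n :=
  \sum_x psi x *: f x.

(* X_d |a> = |a + 1 mod d>; [ordS] is the cyclic successor on 'I_d. *)
Definition shiftX (C : numClosedFieldType) (d : nat) : 'M[C]_d :=
  \matrix_(b, a) (b == ordS a)%:R.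

(* In [CINC i j] and [SUM i j], i is the control and j the target. *)
Inductive gate (C : numClosedFieldType) (d n : nat) :=
| Single of 'I_n & 'M[C]_d
| CINC of 'I_n & 'I_n
| SUM of 'I_n & 'I_n.

Definition gate_op (C : numClosedFieldType) (d n : nat) (g : gate C d n) :
    qvec C d n -> qvec C d n :=
  match g with
  | Single j U => linear_ext (act_factor j U)
  | CINC i j => linear_ext (fun x : word d n =>
      if x i == d.-1 :> nat then act_factor j (shiftX C d) x else ket C x)
  | SUM i j => linear_ext (fun x : word d n =>
      act_factor j (shiftX C d ^+ x i) x)
  end.

(* The side conditions (unitary matrix, control distinct from target) are part
   of the following predicates rather than of the type [gate]. *)
Definition is_single (C : numClosedFieldType) (d n : nat) (g : gate C d n) :=
  if g is Single _ U then U \is unitarymx else false.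

Definition is_CINC (C : numClosedFieldType) (d n : nat) (g : gate C d n) :=
  if g is CINC i j then i != j else false.

Definition is_SUM (C : numClosedFieldType) (d n : nat) (g : gate C d n) :=
  if g is SUM i j then i != j else false.

(* The head of the list is the gate applied first. *)
Definition run (C : numClosedFieldType) (d n : nat) (c : seq (gate C d n))
    (psi : qvec C d n) : qvec C d n :=
  foldl (fun phi g => gate_op g phi) psi c.

(* Main.v *)
Require Import Defs.
From mathcomp Require Import all_boot all_order all_algebra all_fingroup.
From mathcomp Require Import complex reals.
From mathcomp Require Import ring zify.

(* Write |psi> = sum_a |psi_a>|a> and reduce it, undoing gates, to a multiple of
   |0...0>: first reduce psi_0 with no outer control, then each psi_a, a <> 0, with
   the gates that were uncontrolled in the inner reduction now controlled on the
   last letter being a, and finally merge the fiber of the last letter.  Inner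
   controls are always on nonzero letters, so they fix the slices already reduced
   to |0...0>.  All controls are thus single qudits, and the number of
   controlled gates C_k satisfies C_(k+1) = C_k + (d-1)(C_k + k), that is,
   C_n = (d^n-1)/(d-1) - n.

   A controlled gate only has to send some multiple of |0> to a given vector v.
   With CINC, a conjugate P X P^* does this at the cost of a single CINC, because the
   numerical range of X contains [0,1].  With SUM and d prime, (B X^k)^d for B
   diagonal of determinant 1 is the identity for k <> 0 and B^d for k = 0, and
   every unitary is, up to a scalar, a conjugate of such a B^d. *)

Set Implicit Arguments.
Unset Strict Implicit.
Unset Printing Implicit Defensive.
Import Order.TTheory GRing.Theory Num.Theory.
Local Open Scope ring_scope.
Local Open Scope sesquilinear_scope.

(** * Hermitian form, complex reflections and unitaries with prescribed images *)

Section LinearAlgebra.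
Variables (C : numClosedFieldType) (d : nat).
Implicit Types (u v w x y z : 'cV[C]_d) (V P : 'M[C]_d).

Definition cdot u v : C := \sum_b (u b 0)^* * v b 0.

Lemma cdot_mul u v : u^t* *m v = (cdot u v)%:M.
Proof.
by apply/matrixP=> i j; rewrite !ord1 !mxE mulr1n; apply: eq_bigr => b _; rewrite !mxE.
Qed.

Lemma cdotBl u v w : cdot (u - v) w = cdot u w - cdot v w.
Proof. by rewrite -sumrB; apply: eq_bigr => b _; rewrite !mxE rmorphB mulrBl. Qed.

Lemma cdotBr u v w : cdot w (u - v) = cdot w u - cdot w v.
Proof. by rewrite -sumrB; apply: eq_bigr => b _; rewrite !mxE mulrBr. Qed.

Lemma cdotC u v : (cdot u v)^* = cdot v u.
Proof.
by rewrite rmorph_sum; apply: eq_bigr => b _; rewrite rmorphM /= conjCK mulrC.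
Qed.

Lemma cdotDl u v w : cdot (u + v) w = cdot u w + cdot v w.
Proof. by rewrite -big_split; apply: eq_bigr => b _; rewrite !mxE rmorphD mulrDl. Qed.

Lemma cdotDr u v w : cdot w (u + v) = cdot w u + cdot w v.
Proof. by rewrite -big_split; apply: eq_bigr => b _; rewrite !mxE mulrDr. Qed.

Lemma cdotZl a u w : cdot (a *: u) w = a^* * cdot u w.
Proof. by rewrite mulr_sumr; apply: eq_bigr => b _; rewrite !mxE rmorphM mulrA. Qed.

Lemma cdotZr a u w : cdot w (a *: u) = a * cdot w u.
Proof. by rewrite mulr_sumr; apply: eq_bigr => b _; rewrite !mxE mulrCA. Qed.

Lemma cdot_deltal (o : 'I_d) v : cdot (delta_mx o 0) v = v o 0.
Proof.
rewrite /cdot (bigD1 o) //= big1 => [|b bo]; last first.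
  by rewrite mxE (negPf bo) rmorph0 mul0r.
by rewrite mxE !eqxx rmorph1 mul1r addr0.
Qed.

Lemma cdot_deltar (o : 'I_d) v : cdot v (delta_mx o 0) = (v o 0)^*.
Proof. by rewrite -cdotC cdot_deltal. Qed.

Lemma cdot_const1l v : cdot (const_mx 1) v = \sum_b v b 0.
Proof. by apply: eq_bigr => b _; rewrite mxE rmorph1 mul1r. Qed.

Lemma cdot_normE v : cdot v v = \sum_b `|v b 0| ^+ 2.
Proof. by apply: eq_bigr => b _; rewrite normCKC. Qed.

Lemma cdot_eq0 v : cdot v v = 0 -> v = 0.
Proof.
rewrite cdot_normE => /eqP; rewrite psumr_eq0 => [/allP h|b _]; last exact: exprn_ge0.
apply/matrixP=> b j; rewrite ord1 mxE; apply/eqP.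
by have := h b (mem_index_enum _); rewrite expf_eq0 /= normr_eq0.
Qed.

Lemma unitary_cdot V u v : V \is unitarymx -> cdot (V *m u) (V *m v) = cdot u v.
Proof.
move=> VU; suff: (cdot (V *m u) (V *m v))%:M = (cdot u v)%:M :> 'M[C]_1.
  by move=> /matrixP/(_ 0 0); rewrite !mxE !mulr1n.
rewrite -!cdot_mul trmx_mul map_mxM.
by rewrite mulmxA mulmxKtV.
Qed.

Lemma unitarymx1 : (1%:M : 'M[C]_d) \is unitarymx.
Proof. by apply/unitarymxP; rewrite trmx1 map_mx1 mulmx1. Qed.

Lemma scalar_unitary (a : C) V :
  `|a| = 1 -> V \is unitarymx -> a *: V \is unitarymx.
Proof.
move=> a1 /unitarymxP VU; apply/unitarymxP.
rewrite linearZ /= map_mxZ -scalemxAl -scalemxAr scalerA VU.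
by rewrite -normCK a1 expr1n scale1r.
Qed.

(* Complex reflection [1 - u u^* / <u,x>] with [u = x - y]; when [<u,x> = 0]
   one has [u = 0], and Rocq's [0^-1 = 0] makes it the identity. *)
Lemma reflection_exists x y : cdot x x = cdot y y ->
  exists P, [/\ P \is unitarymx, P *m x = y
             & forall z, cdot (x - y) z = 0 -> P *m z = z].
Proof.
move=> exy; set u := x - y; set s := cdot u x; set t := s^-1.
have huu : cdot u u = s + s^*.
  rewrite cdotC /s /u !cdotBl !cdotBr -exy; ring.
pose P := 1%:M - t *: (u *m u^t*).
have Pz z : P *m z = z - (t * cdot u z) *: u.
  rewrite mulmxBl mul1mx -scalemxAl -mulmxA cdot_mul mul_mx_scalar scalerA //.
exists P; split.
- apply/unitarymxP.
  have -> : P ^t* = 1%:M - t^* *: (u *m u^t*).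
    by rewrite linearB linearZ /= map_mxB map_mxZ trmx1 map_mx1 trmx_mul map_mxM trmxCK.
  have uu : (u *m u^t*) *m (u *m u^t*) = cdot u u *: (u *m u^t*).
    by rewrite mulmxA -(mulmxA u) cdot_mul mul_mx_scalar -scalemxAl.
  rewrite mulmxBr mulmx1 mulmxBl mul1mx -scalemxAl -scalemxAr uu !scalerA.
  (* Unitarity of [1 - t u u^*] amounts to this identity; for [s] nonzero and [t = 1/s] it reads
     [s + s^* = <u,u>], which is where [<x,x> = <y,y>] enters. *)
  have tt : t + t^* = t * t^* * cdot u u.
    rewrite huu /t fmorphV /=; move: (s) => {}r; have [->|r0] := eqVneq r 0.
      by rewrite rmorph0 invr0 addr0 !mul0r.
    have r0' : r^* != 0 by rewrite conjC_eq0.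
    by field; apply/andP.
  rewrite -tt; apply/matrixP=> i j; rewrite !mxE; set k := \sum_ _ _; set o := _%:R.
  by ring.
- rewrite Pz -/s; have [s0|s0] := eqVneq s 0.
    have u0 : u = 0 by apply: cdot_eq0; rewrite huu s0 rmorph0 addr0.
    by rewrite u0 scaler0 subr0; apply/subr0_eq.
  by rewrite mulVf // scale1r /u opprB addrC subrK.
- by move=> z z0; rewrite Pz z0 mulr0 scale0r subr0.
Qed.

(** One reflection sends [x1] to [y1]; a second one sends [P *m x2] to [y2] and fixes [y1], because
    equal inner products make [y1] orthogonal to [P *m x2 - y2]. *)
Lemma pair_unitary_exists x1 x2 y1 y2 :
  cdot x1 x1 = cdot y1 y1 -> cdot x2 x2 = cdot y2 y2 -> cdot x1 x2 = cdot y1 y2 ->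
  exists P, [/\ P \is unitarymx, P *m x1 = y1 & P *m x2 = y2].
Proof.
move=> e1 e2 e12; have [P [PU P1 _]] := reflection_exists e1.
have [|Q [QU Q2 Qfix]] := @reflection_exists (P *m x2) y2; first by rewrite unitary_cdot.
exists (Q *m P); split; first exact: mul_unitarymx.
  rewrite -mulmxA P1; apply: Qfix; rewrite -P1 cdotBl unitary_cdot // -[cdot y2 _]cdotC.
  by rewrite P1 -e12 cdotC subrr.
by rewrite -mulmxA.
Qed.



(** * The shift matrix and its conjugates *)

Lemma shiftX_perm : shiftX C d = perm_mx (perm (@ordS_inj d))^-1.
Proof.
by rewrite -tr_perm_mx; apply/matrixP=> b a; rewrite !mxE permE eq_sym.
Qed.

Lemma perm_mx_unitary (s : {perm 'I_d}) : (perm_mx s : 'M[C]_d) \is unitarymx.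
Proof.
by apply/unitarymxP; rewrite tr_perm_mx map_perm_mx -perm_mxM mulgV perm_mx1.
Qed.

Lemma shiftX_unitary : shiftX C d \is unitarymx.
Proof. by rewrite shiftX_perm perm_mx_unitary. Qed.

Lemma shiftX_delta (a : 'I_d) :
  shiftX C d *m delta_mx a 0 = delta_mx (ordS a) 0 :> 'cV_d.
Proof.
apply/matrixP=> b j; rewrite ord1 !mxE (bigD1 a) //= big1 => [|c ca].
  by rewrite !mxE !eqxx mulr1 addr0 andbT.
by rewrite !mxE (negPf ca) mulr0.
Qed.

Lemma shiftX_const (c : C) : shiftX C d *m const_mx c = const_mx c :> 'cV_d.
Proof.
apply/matrixP=> b j; rewrite !mxE (bigD1 (ord_pred b)) //= big1 => [|a ab].
  by rewrite !mxE ord_predK eqxx mul1r addr0.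
rewrite !mxE; case: eqP => [ba|_]; last by rewrite mul0r.
by rewrite ba ordSK eqxx in ab.
Qed.

Lemma ordS_neq (a : 'I_d) : (1 < d)%N -> ordS a != a.
Proof.
case: d a => // -[] // m a _; rewrite -val_eqE /=.
have [lt|] := ltnP a.+1 m.+2; first by rewrite modn_small // neq_ltn ltnSn orbT.
by rewrite leq_eqVlt ltnNge ltn_ord orbF => /eqP[aE]; rewrite -aE modnn.
Qed.

(** Give [la] the norm of [v] as modulus and the phase of [v o 0]: the overlap of [la|o>] with [v]
    then lies in [[0, N]], a range of overlaps that the shift can realize. *)
Lemma aligned_phase (o : 'I_d) v (N := cdot v v) :
  exists la : C, [/\ la^* * la = N, 0 <= la^* * v o 0 & la^* * v o 0 <= N].
Proof.
have N0 : 0 <= N by rewrite /N cdot_normE sumr_ge0 // => b _; apply: exprn_ge0.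
have voN : `|v o 0| <= sqrtC N.
  rewrite -ler_sqr ?nnegrE ?sqrtC_ge0 // sqrtCK /N cdot_normE (bigD1 o) //= lerDl.
  by apply: sumr_ge0 => b _; apply: exprn_ge0.
have s0 : 0 <= sqrtC N by rewrite sqrtC_ge0.
have sc : (sqrtC N)^* = sqrtC N by apply/CrealP; apply: ger0_real.
have [vo|vo] := eqVneq (v o 0) 0.
  exists (sqrtC N); rewrite sc -expr2 sqrtCK vo mulr0; split=> //.
exists (sqrtC N * (v o 0 / `|v o 0|)).
have nv : `|v o 0| != 0 by rewrite normr_eq0.
have e : (v o 0)^* * v o 0 = `|v o 0| ^+ 2 by rewrite normCKC.
have cn : (`|v o 0|)^* = `|v o 0| by apply/CrealP; apply: normr_real.
rewrite !rmorphM fmorphV /= sc cn.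
have -> : sqrtC N * ((v o 0)^* / `|v o 0|) * v o 0 = sqrtC N * `|v o 0|.
  by rewrite -mulrA -[_ / _ * _]mulrAC e expr2 mulfK.
split.
- rewrite mulrACA -expr2 sqrtCK mulrACA e -invfM -expr2 divff ?mulr1 //.
  by rewrite expf_eq0.
- by rewrite mulr_ge0.
- by rewrite -[X in _ <= X]sqrtCK expr2 ler_wpM2l.
Qed.

(* The numerical range of [shiftX] contains [0, 1]: the vector a|o> + b(1,...,1)
   of squared norm [N] has overlap [N - a^2] with its own shift. *)
Lemma shift_overlap_exists (o : 'I_d) (N r : C) : (1 < d)%N -> 0 <= r -> r <= N ->
  exists w : 'cV[C]_d, cdot w w = N /\ cdot w (shiftX C d *m w) = r.
Proof.
move=> d1 r0 rN; have Nr : 0 <= N - r by rewrite subr_ge0.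
have dN0 : d%:R != 0 :> C by rewrite pnatr_eq0 -lt0n ltnW.
(* The two requirements become [a^2 = N - r] and [2ab + d b^2 = r], since the shift fixes the
   constant vector and moves [o]; [b] is a root of the second and [g^2] its reduced discriminant. *)
pose a := sqrtC (N - r); pose g := sqrtC (a ^+ 2 + d%:R * r).
have a0 : 0 <= a by rewrite sqrtC_ge0.
have g0 : 0 <= g by rewrite sqrtC_ge0 addr_ge0 ?exprn_ge0 // mulr_ge0 // ler0n.
pose b := (g - a) / d%:R.
have ac : a^* = a by apply/CrealP/ger0_real.
have bc : b^* = b.
  by apply/CrealP/realM; [apply: realB; apply: ger0_real | rewrite realV realn].
have aE : a ^+ 2 = N - r by rewrite sqrtCK.
have bE : 2 * a * b + d%:R * b ^+ 2 = r.
  have gE : g ^+ 2 = a ^+ 2 + d%:R * r by rewrite sqrtCK.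
  have -> : r = (g ^+ 2 - a ^+ 2) / d%:R by rewrite gE; field.
  by rewrite /b; field.
have S1 : \sum_(i < d) (const_mx 1 : 'cV[C]_d) i 0 = d%:R.
  by under eq_bigr do rewrite mxE; rewrite sumr_const card_ord.
exists (a *: delta_mx o 0 + b *: const_mx 1).
rewrite mulmxDr -!scalemxAr shiftX_delta shiftX_const.
rewrite !(cdotDl, cdotDr, cdotZl, cdotZr) ac bc !cdot_deltal !cdot_deltar !cdot_const1l S1.
rewrite !mxE !eqxx [o == _]eq_sym (negPf (ordS_neq _ _)) // !rmorph1 /=; split.
  by rewrite -[N](subrK r) -aE -[X in _ = _ + X]bE; ring.
by rewrite -[RHS]bE; ring.
Qed.

(** Choose [w] with the norm of [v] and with [<w, X w>] equal to the overlap of [la|o>] and [v]. One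
    unitary [P] then sends [w] to [la|o>] and [X w] to [v], so [P X P^*] sends [la|o>] to [v]. *)
Lemma shift_conj_exists (o : 'I_d) v : (1 < d)%N ->
  exists (P : 'M[C]_d) (la : C),
    P \is unitarymx /\ P *m shiftX C d *m P^t* *m (la *: delta_mx o 0) = v.
Proof.
move=> d1; have [la [laN r0 rN]] := aligned_phase o v.
have [w [wN wr]] := shift_overlap_exists o d1 r0 rN.
have [P [PU Pw PXw]] : exists P,
    [/\ P \is unitarymx, P *m w = la *: delta_mx o 0 & P *m (shiftX C d *m w) = v].
  apply: pair_unitary_exists.
  - by rewrite wN cdotZl cdotZr cdot_deltal !mxE !eqxx mulr1.
  - by rewrite unitary_cdot ?shiftX_unitary.
  - by rewrite wr cdotZl cdot_deltal.
exists P, la; split=> //.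
rewrite -Pw -!mulmxA [P^t* *m _]mulmxA.
by have := trmxC_unitary P; rewrite PU => /unitarymxP; rewrite trmxCK => ->; rewrite mul1mx.
Qed.

(** * Powers of a diagonal matrix times a power of the shift *)

Lemma iter_ordS k (j : 'I_d) : iter k (@ordS d) j = ((j + k) %% d)%N :> nat.
Proof.
elim: k => [|k IH]; first by rewrite addn0 modn_small.
by rewrite iterS /= IH addnS -addn1 modnDml addn1.
Qed.

Lemma iter_iter_ordS k m (j : 'I_d) :
  iter m (iter k (@ordS d)) j = ((j + m * k) %% d)%N :> nat.
Proof.
elim: m => [|m IH]; first by rewrite addn0 modn_small.
by rewrite iterS iter_ordS IH modnDml mulSn -addnA [(k + _)%N]addnC.
Qed.

Lemma shiftX_exp k : shiftX C d ^+ k = \matrix_(i, j) (i == iter k (@ordS d) j)%:R.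
Proof.
elim: k => [|k IH]; first by apply/matrixP=> i j; rewrite expr0 -idmxE !mxE.
rewrite exprS -mulmxE IH; apply/matrixP=> i j.
rewrite !mxE (bigD1 (iter k (@ordS d) j)) //= big1 => [|c ca].
  by rewrite !mxE !eqxx mulr1 addr0.
by rewrite !mxE (negPf ca) mulr0.
Qed.

(** The matrix is monomial: each power moves column [j] along its orbit and collects the entries of
    [b] met there. The index [l.+1] appears because the shift acts before the diagonal. *)
Lemma diag_shift_exp (b : 'rV[C]_d) k m :
  (diag_mx b *m shiftX C d ^+ k) ^+ m =
  \matrix_(i, j) ((i == iter m (iter k (@ordS d)) j)%:R *
                  \prod_(l < m) b 0 (iter l.+1 (iter k (@ordS d)) j)).
Proof.
set f := iter k _; elim: m => [|m IH].
  by apply/matrixP=> i j; rewrite expr0 -idmxE !mxE big_ord0 mulr1.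
rewrite exprS -mulmxE IH shiftX_exp -/f; apply/matrixP=> i j.
rewrite mul_diag_mx !mxE (bigD1 (iter m f j)) //= big1 => [|c ca]; last first.
  by rewrite !mxE (negPf ca) mul0r mulr0.
rewrite !mxE eqxx mul1r addr0 big_ord_recr /=.
case: eqP => [->|_]; last by rewrite mulr0 !mul0r.
by rewrite mulr1 mul1r mulrC.
Qed.

(* [X^k] is a d-cycle when d is prime and 0 < k < d, so the d-th power of
   [B X^k] collects every diagonal entry of [B] exactly once. *)
Lemma diag_shift_cycle (b : 'rV[C]_d) k : prime d -> (0 < k < d)%N ->
  \prod_i b 0 i = 1 -> (diag_mx b *m shiftX C d ^+ k) ^+ d = 1%:M.
Proof.
move=> pd /andP[k0 kd] b1; rewrite diag_shift_exp.
apply/matrixP=> i j; rewrite !mxE; set f := iter k _.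
have -> : iter d f j = j.
  by apply/val_inj; rewrite /= iter_iter_ordS addnC mulnC modnMDl modn_small.
(* [h] walks the orbit of [j]. Equal values at [l] and [l'] make [d] divide [(l' - l) * k];
   primality, [0 < k < d] and [l' - l < d] force [l = l']. *)
pose h (l : 'I_d) : 'I_d := iter l.+1 f j.
have hinj : injective h.
  have hE (l : 'I_d) : h l = ((j + l.+1 * k) %% d)%N :> nat := iter_iter_ordS _ _ _.
  move=> l l' /(congr1 val)/eqP; rewrite /= !hE eqn_modDl.
  wlog ll : l l' / (l <= l')%N => [W|].
    by case: (leqP l l') => [/W//|/ltnW/W h']; rewrite eq_sym => /h' ->.
  rewrite eq_sym eqn_mod_dvd ?leq_mul2r ?ltnS ?ll ?orbT // -mulnBl subSS Euclid_dvdM //.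
  rewrite [(d %| k)%N]gtnNdvd // orbF => dl; apply/val_inj/eqP.
  rewrite eqn_leq ll /= -subn_eq0; move: dl.
  case: (l' - l)%N (leq_ltn_trans (leq_subr l l') (ltn_ord l')) => // p pl.
  by rewrite gtnNdvd.
by rewrite (reindex_inj hinj) in b1; rewrite b1 mulr1.
Qed.

Lemma diag_unitary (b : 'rV[C]_d) : (forall i, `|b 0 i| = 1) -> diag_mx b \is unitarymx.
Proof.
move=> b1; apply/unitarymxP; rewrite tr_diag_mx map_diag_mx mul_diag_mx.
apply/matrixP=> i j; rewrite !mxE; case: eqP => [->|_]; last by rewrite mulr0n mulr0.
by rewrite !mulr1n -normCK b1 expr1n.
Qed.

Lemma diag_unitary_norm (b : 'rV[C]_d) i : diag_mx b \is unitarymx -> `|b 0 i| = 1.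
Proof.
move=> /unitarymxP; rewrite tr_diag_mx map_diag_mx mul_diag_mx => /matrixP/(_ i i).
rewrite !mxE eqxx !mulr1n -normCK => /eqP.
by rewrite pexpr_eq1 ?normr_ge0 // => /eqP.
Qed.

Lemma rootC_norm1 (z : C) : (0 < d)%N -> `|z| = 1 -> `|d.-root z| = 1.
Proof.
move=> d0 z1; apply/eqP; rewrite -(@pexpr_eq1 _ _ d) ?normr_ge0 //.
by rewrite -normrX rootCK // z1.
Qed.

Lemma diag_mx_exp (b : 'rV[C]_d) k : diag_mx b ^+ k = diag_mx (\row_i b 0 i ^+ k).
Proof.
elim: k => [|k IH].
  by rewrite expr0 -idmxE -diag_const_mx; congr diag_mx; apply/matrixP=> i j; rewrite !mxE.
rewrite exprS -mulmxE IH mul_diag_mx; apply/matrixP=> i j; rewrite !mxE.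
by case: eqP; rewrite ?mulr0n ?mulr0 ?mulr1n ?exprS.
Qed.

Lemma unitary_preparation (o : 'I_d) v : exists (V : 'M[C]_d) (la : C),
  V \is unitarymx /\ V *m (la *: delta_mx o 0) = v.
Proof.
have [la [laN _ _]] := aligned_phase o v.
have [|V [VU Vv _]] := @reflection_exists (la *: delta_mx o 0) v.
  by rewrite cdotZl cdotZr cdot_deltal !mxE !eqxx mulr1.
by exists V, la.
Qed.

(** Diagonalize a unitary [V] that prepares [v] and take [d]-th roots of its eigenvalues. Dividing
    them by a [d]-th root of their product [be] makes the determinant 1 and turns [V] into
    [be^-1 V]; the scalar is absorbed in [la]. *)
Lemma diag_cycle_exists (o : 'I_d) v : prime d ->
  exists (b : 'rV[C]_d) (P : 'M[C]_d) (la : C),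
    [/\ diag_mx b \is unitarymx, \prod_i b 0 i = 1, P \is unitarymx &
        P *m diag_mx b ^+ d *m P^t* *m (la *: delta_mx o 0) = v].
Proof.
move=> pd; have d0 := prime_gt0 pd; have [V [mu [VU Vv]]] := unitary_preparation o v.
have Vn : V \is normalmx.
  apply/normalmxP; rewrite (unitarymxP VU).
  by have := trmxC_unitary V; rewrite VU => /unitarymxP; rewrite trmxCK.
have := orthomx_spectralP Vn; set Q := spectralmx V; set D := spectral_diag V.
have QU : Q \is unitarymx by apply: spectral_unitarymx.
rewrite invmx_unitary // => VE.
have D1 i : `|D 0 i| = 1.
  apply: diag_unitary_norm; have -> : diag_mx D = Q *m V *m Q^t*.
    by rewrite VE !mulmxA (unitarymxP QU) mul1mx mulmxtVK.
  by rewrite !mul_unitarymx // trmxC_unitary.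
pose be := \prod_i d.-root (D 0 i); pose et := d.-root be.
have be1 : `|be| = 1 by rewrite normr_prod big1 // => i _; apply: rootC_norm1.
have et1 : `|et| = 1 by apply: rootC_norm1.
have be0 : be != 0 by rewrite -normr_eq0 be1 oner_eq0.
exists (\row_i (d.-root (D 0 i) / et)), (Q^t*), (be * mu); split.
- by apply: diag_unitary => i; rewrite mxE normf_div et1 divr1 rootC_norm1.
- under eq_bigr do rewrite mxE.
  by rewrite prodf_div prodr_const card_ord rootCK // divff.
- by rewrite trmxC_unitary.
rewrite trmxCK diag_mx_exp; set D' := (X in diag_mx X).
have -> : D' = be^-1 *: D.
  by apply/matrixP=> a i; rewrite ord1 !mxE expr_div_n !rootCK // mulrC.
rewrite -scalemxAr linearZ /= -!scalemxAr -!scalemxAl -VE scalerA.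
by rewrite -Vv -scalemxAr mulrAC divff // mul1r.
Qed.

End LinearAlgebra.

(** * Replacing one letter of a word *)

Section SetFactor.
Variables (d n : nat).
Implicit Types (x y : word d n) (i j : 'I_n) (a b : 'I_d).

Lemma set_factor_at x j a : set_factor x j a j = a.
Proof. by rewrite ffunE eqxx. Qed.

Lemma set_factor_ne x i j a : i != j -> set_factor x j a i = x i.
Proof. by move=> ij; rewrite ffunE (negPf ij). Qed.

Lemma set_factor_id x j : set_factor x j (x j) = x.
Proof. by apply/ffunP=> i; rewrite ffunE; case: eqP => [->|]. Qed.

Lemma set_factor_twice x j a b : set_factor (set_factor x j a) j b = set_factor x j b.
Proof. by apply/ffunP=> i; rewrite !ffunE; case: eqP. Qed.

Lemma set_factorC x i j a b : i != j ->
  set_factor (set_factor x i a) j b = set_factor (set_factor x j b) i a.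
Proof.
move=> ij; apply/ffunP=> k; rewrite !ffunE; case: (eqVneq k j) => [->|//].
by rewrite eq_sym (negPf ij).
Qed.

End SetFactor.

(** * Gates as operators on fibers, and circuits with counted gates *)

Section Circuits.
Variables (C : numClosedFieldType) (d n : nat).
Implicit Types (x y : word d n) (i j : 'I_n) (a b o : 'I_d) (psi phi : qvec C d n).
Implicit Types (M N : word d n -> 'M[C]_d) (V P : 'M[C]_d) (c : seq (gate C d n)).
Implicit Types (op : qvec C d n -> qvec C d n) (g : pred (gate C d n)).

(** Common form of all the gates: a matrix on factor [j] that may depend on the other letters.
    [fiber_const] excludes dependence on the letter [j] itself, so that composition multiplies the
    matrices. *)
Definition fiber_op j M psi : qvec C d n :=
  [ffun x => \sum_a M x (x j) a * psi (set_factor x j a)].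

Lemma fiber_opE j M psi x :
  fiber_op j M psi x = \sum_a M x (x j) a * psi (set_factor x j a).
Proof. by rewrite ffunE. Qed.

Definition fiber_const j M := forall x a, M (set_factor x j a) = M x.

Definition controlled i a V x : 'M[C]_d := if x i == a then V else 1%:M.

Lemma controlled_const i j a V : i != j -> fiber_const j (controlled i a V).
Proof. by move=> ij x b; rewrite /controlled set_factor_ne. Qed.

(** [linear_ext] reads the matrix at the input word, [fiber_op] at the output word; the two differ
    only at [j], so [fiber_const] reconciles them. *)
Lemma linear_ext_act_factor j M psi : fiber_const j M ->
  linear_ext (fun x => act_factor j (M x) x) psi = fiber_op j M psi.
Proof.
move=> Mj; apply/ffunP=> x; rewrite !ffunE sum_ffunE.
transitivity (\sum_(y : word d n | y == set_factor x j (y j)) psi y * M y (x j) (y j)).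
  rewrite [RHS]big_mkcond /=; apply: eq_bigr => y _.
  rewrite !ffunE sum_ffunE (bigD1 (x j)) //= big1 => [|b bx]; last first.
    rewrite !ffunE; case: eqP => [xE|_]; last by rewrite scaler0.
    by rewrite {1}xE set_factor_at eqxx in bx.
  rewrite !ffunE addr0.
  have -> : (x == set_factor y j (x j)) = (y == set_factor x j (y j)).
    apply/eqP/eqP => E; last by rewrite E set_factor_twice set_factor_id.
    by rewrite {1}E set_factor_twice set_factor_id.
  by case: eqP => _; rewrite /GRing.scale /= ?mulr1 ?mulr0.
rewrite (reindex_onto (fun a => set_factor x j a) (fun y : word d n => y j)) /=; last first.
  by move=> y /eqP.
apply: eq_big => [a|a _]; rewrite !set_factor_at ?eqxx //.
by rewrite Mj mulrC.
Qed.

Lemma fiber_opM j M N psi : fiber_const j N ->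
  fiber_op j M (fiber_op j N psi) = fiber_op j (fun x => M x *m N x) psi.
Proof.
move=> Nj; apply/ffunP=> x; rewrite !fiber_opE.
under eq_bigr do rewrite fiber_opE mulr_sumr.
rewrite exchange_big /=; apply: eq_bigr => b _.
rewrite mxE mulr_suml; apply: eq_bigr => a _.
by rewrite Nj set_factor_at set_factor_twice mulrA.
Qed.

Lemma eq_fiber_op j M N : M =1 N -> fiber_op j M =1 fiber_op j N.
Proof. by move=> MN psi; apply/ffunP=> x; rewrite !fiber_opE MN. Qed.

Lemma fiber_op1 j psi : fiber_op j (fun=> 1%:M) psi = psi.
Proof.
apply/ffunP=> x; rewrite ffunE (bigD1 (x j)) //= big1 => [|a ax].
  by rewrite mxE eqxx mul1r addr0 set_factor_id.
by rewrite mxE eq_sym (negPf ax) mul0r.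
Qed.

Lemma fiber_op_perm i (s : {perm 'I_d}) psi x :
  fiber_op i (fun=> perm_mx s) psi x = psi (set_factor x i (s (x i))).
Proof.
rewrite ffunE (bigD1 (s (x i))) //= big1 => [|a ax].
  by rewrite !mxE eqxx mul1r addr0.
by rewrite !mxE eq_sym (negPf ax) mul0r.
Qed.

Lemma fiber_op_relabel i j (s : {perm 'I_d}) M psi : i != j ->
  fiber_op i (fun=> perm_mx s) (fiber_op j M (fiber_op i (fun=> perm_mx s^-1) psi)) =
  fiber_op j (fun x => M (set_factor x i (s (x i)))) psi.
Proof.
move=> ij; apply/ffunP=> x; rewrite fiber_op_perm !fiber_opE.
have ji : j != i by rewrite eq_sym.
rewrite set_factor_ne //; apply: eq_bigr => a _.
rewrite fiber_op_perm set_factor_ne // set_factor_at permK set_factorC //.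
by rewrite set_factor_twice set_factor_id.
Qed.

(** The pairs [(x, a)] carry an involution that exchanges [a] with the letter of [x] at [j], so
    every word is counted [d] times. *)
Lemma sum_fibers (F : word d n -> C) j :
  \sum_x \sum_a F (set_factor x j a) = d%:R * \sum_x F x.
Proof.
rewrite pair_big /=.
rewrite (reindex (fun p : word d n * 'I_d => (set_factor p.1 j p.2, p.1 j))) /=; last first.
  apply: onW_bij; exists (fun p : word d n * 'I_d => (set_factor p.1 j p.2, p.1 j)).
    by case=> x a /=; rewrite set_factor_twice set_factor_id set_factor_at.
  by case=> x a /=; rewrite set_factor_twice set_factor_id set_factor_at.
transitivity (\sum_(p : word d n * 'I_d) F p.1).
  by apply: eq_bigr => -[x a] _ /=; rewrite set_factor_twice set_factor_id.
rewrite -(pair_big xpredT xpredT (fun x (_ : 'I_d) => F x)) /= mulr_sumr.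
by apply: eq_bigr => x _; rewrite sumr_const card_ord mulr_natl.
Qed.

(** Multiplying by [d] turns both sides into sums over fibers without choosing representatives; on
    each fiber a single unitary acts. *)
Lemma fiber_op_norm j M psi : (0 < d)%N -> fiber_const j M ->
  (forall x, M x \is unitarymx) ->
  \sum_x `|fiber_op j M psi x| ^+ 2 = \sum_x `|psi x| ^+ 2.
Proof.
move=> d0 Mj MU; have dn0 : d%:R != 0 :> C by rewrite pnatr_eq0 -lt0n.
apply: (mulfI dn0); rewrite -!(sum_fibers _ j); apply: eq_bigr => x _.
pose v : 'cV[C]_d := \col_a psi (set_factor x j a).
transitivity (cdot (M x *m v) (M x *m v)).
  rewrite cdot_normE; apply: eq_bigr => a _; rewrite fiber_opE mxE Mj set_factor_at.
  by congr (`|_| ^+ 2); apply: eq_bigr => b _; rewrite mxE set_factor_twice.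
by rewrite unitary_cdot // cdot_normE; apply: eq_bigr => a _; rewrite mxE.
Qed.

Lemma run_cat c1 c2 psi : run (c1 ++ c2) psi = run c2 (run c1 psi).
Proof. exact: foldl_cat. Qed.

Lemma run_Single j V psi : gate_op (Single j V) psi = fiber_op j (fun=> V) psi.
Proof. exact: linear_ext_act_factor. Qed.

Lemma run_SUM i j psi : i != j ->
  gate_op (SUM C d i j) psi = fiber_op j (fun x => shiftX C d ^+ x i) psi.
Proof.
by move=> ij; apply: linear_ext_act_factor => x a; rewrite set_factor_ne.
Qed.

Lemma act_factor1 j x : act_factor j 1%:M x = ket C x.
Proof.
rewrite /act_factor (bigD1 (x j)) //= big1 => [|b bx].
  by rewrite mxE eqxx scale1r addr0 set_factor_id.
by rewrite mxE (negPf bx) scale0r.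
Qed.

Lemma run_CINC i j psi : i != j -> gate_op (CINC C d i j) psi =
  fiber_op j (fun x => if x i == d.-1 :> nat then shiftX C d else 1%:M) psi.
Proof.
move=> ij; rewrite -linear_ext_act_factor => [|x a]; last by rewrite set_factor_ne.
by apply: eq_bigr => x _; case: ifP; rewrite ?act_factor1.
Qed.

Definition realizes g m op := exists c,
  [/\ all (fun h => g h || is_single h) c, (count g c <= m)%N & run c =1 op].

Definition entangler g := forall h, g h -> ~~ is_single h.

Lemma realizes_ext g m op op' : op =1 op' -> realizes g m op -> realizes g m op'.
Proof. by move=> E [c [? ? cE]]; exists c; split=> // psi; rewrite cE. Qed.

Lemma realizes_id g m : realizes g m id.
Proof. by exists [::]. Qed.

Lemma realizes_comp g m1 m2 op1 op2 : realizes g m1 op1 -> realizes g m2 op2 ->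
  realizes g (m2 + m1) (op1 \o op2).
Proof.
move=> [c1 [a1 l1 r1]] [c2 [a2 l2 r2]]; exists (c2 ++ c1); split.
- by rewrite all_cat a2.
- by rewrite count_cat leq_add.
- by move=> psi; rewrite run_cat r2 r1.
Qed.

Lemma realizes_single g j V : entangler g -> V \is unitarymx ->
  realizes g 0 (fiber_op j (fun=> V)).
Proof.
move=> gS VU; exists [:: Single j V]; split=> /=.
- by rewrite VU orbT.
- by case: (boolP (g _)) => // /gS /=; rewrite VU.
- by move=> psi; rewrite -run_Single.
Qed.

Lemma realizes_gate g h : g h -> realizes g 1 (gate_op h).
Proof. by move=> gh; exists [:: h]; rewrite /= gh. Qed.

Lemma realizes_iter g m k op : realizes g m op -> realizes g (k * m) (iter k op).
Proof.
move=> ro; elim: k => [|k IH]; first exact: realizes_id.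
by rewrite mulSn addnC; apply: (realizes_comp ro IH).
Qed.

Lemma iter_fiber_op j M k psi : fiber_const j M ->
  iter k (fiber_op j M) psi = fiber_op j (fun x => M x ^+ k) psi.
Proof.
move=> Mj; elim: k => [|k IH]; first by rewrite fiber_op1.
rewrite iterS IH fiber_opM => [|x a]; last by rewrite Mj.
by apply: eq_fiber_op => x; rewrite exprS mulmxE.
Qed.

Lemma realizes_target_conj g m j M P : entangler g -> P \is unitarymx ->
  fiber_const j M -> realizes g m (fiber_op j M) ->
  realizes g m (fiber_op j (fun x => P *m M x *m P^t*)).
Proof.
move=> gS PU Mj rM.
have r1 := realizes_single j gS PU.
have r2 : realizes g 0 (fiber_op j (fun=> P^t*)).
  by apply: realizes_single; rewrite ?trmxC_unitary.
have := realizes_comp r1 (realizes_comp rM r2); rewrite addn0.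
apply: realizes_ext => psi /=.
by rewrite fiber_opM // fiber_opM.
Qed.

Lemma realizes_control_relabel g m i j (s : {perm 'I_d}) M : entangler g -> i != j ->
  realizes g m (fiber_op j M) ->
  realizes g m (fiber_op j (fun x => M (set_factor x i (s (x i))))).
Proof.
move=> gS ij rM.
have r (t : {perm 'I_d}) : realizes g 0 (fiber_op i (fun=> perm_mx t)).
  by apply: realizes_single => //; apply: perm_mx_unitary.
have := realizes_comp (r s) (realizes_comp rM (r s^-1)%g); rewrite addn0.
by apply: realizes_ext => psi /=; rewrite fiber_op_relabel.
Qed.

(** The conjugating gates need no control: where the gate is inactive, [P P^* = 1]. Swapping [a] and
    [b] on the control factor moves the activating letter from [b] to [a]. *)
Lemma realizes_controlled g m i j a b V P : entangler g -> i != j -> P \is unitarymx ->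
  realizes g m (fiber_op j (controlled i b V)) ->
  realizes g m (fiber_op j (controlled i a (P *m V *m P^t*))).
Proof.
move=> gS ij PU /(realizes_target_conj gS PU (controlled_const _ _ ij)).
move=> /(realizes_control_relabel (tperm a b) gS ij).
apply: realizes_ext; apply: eq_fiber_op => x; rewrite /controlled set_factor_at.
rewrite -[X in _ == X](tpermL a b) (inj_eq perm_inj).
by case: eqP => // _; rewrite mulmx1 (unitarymxP PU).
Qed.

(** All that the reduction asks of a gate set. Only one column of [V] is prescribed, up to the
    scalar [la]; this freedom keeps [m] small. *)
Definition controlled_kit g m := forall i j a o (v : 'cV[C]_d), i != j ->
  exists V (la : C), [/\ V \is unitarymx, V *m (la *: delta_mx o 0) = v
    & realizes g m (fiber_op j (controlled i a V))].

Lemma CINC_entangler : entangler (@is_CINC C d n).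
Proof. by case. Qed.

Lemma SUM_entangler : entangler (@is_SUM C d n).
Proof. by case. Qed.

Lemma CINC_kit : (1 < d)%N -> controlled_kit (@is_CINC C d n) 1.
Proof.
move=> d1 i j a o v ij; have [P [la [PU Pv]]] := shift_conj_exists o v d1.
exists (P *m shiftX C d *m P^t*), la; split=> //.
  by rewrite !mul_unitarymx ?shiftX_unitary // trmxC_unitary.
have lt : (d.-1 < d)%N by rewrite prednK // ltnW.
apply: (@realizes_controlled _ _ _ _ _ (Ordinal lt)) => //; first exact: CINC_entangler.
apply: (@realizes_ext _ _ (gate_op (CINC C d i j))); last exact: realizes_gate.
by move=> psi; rewrite run_CINC //; apply: eq_fiber_op.
Qed.

(** A round is SUM followed by the diagonal gate on the target. The [d] rounds form a controlled
    gate activated by the letter 0, which relabelling moves to [a]. *)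
Lemma SUM_kit : prime d -> controlled_kit (@is_SUM C d n) d.
Proof.
move=> pd i j a o v ij; have [b [P [la [bU b1 PU Pv]]]] := diag_cycle_exists o v pd.
have bdU : diag_mx b ^+ d \is unitarymx.
  elim: (d in X in _ ^+ X) => [|k IH]; first by rewrite expr0 -idmxE unitarymx1.
  by rewrite exprS -mulmxE mul_unitarymx.
exists (P *m diag_mx b ^+ d *m P^t*), la; split=> //.
  by rewrite !mul_unitarymx // trmxC_unitary.
apply: (@realizes_controlled _ _ _ _ _ (Ordinal (prime_gt0 pd))) => //.
  exact: SUM_entangler.
have rS : realizes (@is_SUM C d n) 1 (gate_op (SUM C d i j)) by apply: realizes_gate.
have rB := realizes_single j SUM_entangler bU.
have := realizes_iter d (realizes_comp rB rS); rewrite addn0 muln1.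
have Xj : fiber_const j (fun x => shiftX C d ^+ x i).
  by move=> x c; rewrite set_factor_ne.
apply: realizes_ext => psi.
have -> : iter d (fiber_op j (fun=> diag_mx b) \o gate_op (SUM C d i j)) psi =
   iter d (fiber_op j (fun x => diag_mx b *m shiftX C d ^+ x i)) psi.
  by apply: eq_iter => phi; rewrite [LHS]/comp run_SUM // fiber_opM.
rewrite iter_fiber_op => [|x c]; last by rewrite Xj.
apply: eq_fiber_op => x; rewrite /controlled -val_eqE /=.
case: posnP => [->|x0]; first by rewrite expr0 -idmxE mulmx1.
by rewrite diag_shift_cycle // x0 ltn_ord.
Qed.

End Circuits.

(** * Recursive reduction of a state to a multiple of a basis vector *)

Section Reduction.
Variables (C : numClosedFieldType) (d n : nat) (o : 'I_d).
Variables (g : pred (gate C d n)) (K : nat).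
Hypotheses (gS : entangler g) (kit : controlled_kit g K).
Implicit Types (x y z : word d n) (i j : 'I_n) (a b : 'I_d) (psi phi : qvec C d n).
Implicit Types (ctl : option ('I_n * 'I_d)) (k m : nat).

Definition active ctl x := if ctl is Some (i, a) then x i == a else true.

Definition ctl_above k ctl := if ctl is Some (i, _) then (k <= i)%N else true.

Definition agree k x z := forall i, (k <= i)%N -> x i = z i.

(** [z] stands for the slice of words sharing its letters from position [k] on; on it, [psi] may be
    nonzero only where the first [k] letters are [o]. *)
Definition concentrated k z psi := forall x, agree k x z ->
  (exists2 i : 'I_n, (i < k)%N & x i != o) -> psi x = 0.

Definition vanishing k z psi := forall x, agree k x z -> psi x = 0.

(** Inner controls replace the outer one, so gates may act where [ctl] is inactive; concentration
    survives there. Vanishing is tracked on all slices because a concentrated slice of level [k.+1]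
    splits into one concentrated and [d - 1] vanishing subslices. *)
Definition preserves k ctl psi phi := forall z,
  (~~ active ctl z -> concentrated k z psi -> concentrated k z phi) /\
  (vanishing k z psi -> vanishing k z phi).

(** The circuit runs from [phi] back to [psi], since the reduction undoes gates. Equality of norms
    makes the final scalar a phase. *)
Definition reduces m psi phi :=
  (exists2 op, realizes g (K * m) op & op phi = psi) /\
  \sum_x `|phi x| ^+ 2 = \sum_x `|psi x| ^+ 2.

Lemma reduces_refl psi : reduces 0 psi psi.
Proof. by split=> //; exists id; rewrite ?muln0 //; apply: realizes_id. Qed.

Lemma reduces_trans m1 m2 psi1 psi2 psi3 :
  reduces m1 psi1 psi2 -> reduces m2 psi2 psi3 -> reduces (m1 + m2) psi1 psi3.
Proof.
move=> [[op1 r1 e1] n1] [[op2 r2 e2] n2]; split; last by rewrite n2.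
exists (op1 \o op2); first by rewrite addnC mulnDr; apply: realizes_comp.
by rewrite /= e2.
Qed.

Lemma active_agree k ctl x z : ctl_above k ctl -> agree k x z ->
  active ctl x = active ctl z.
Proof. by case: ctl => [[i a]|] //= ki /(_ i ki) ->. Qed.

Lemma agree_set k j x z b : j = k :> nat -> agree k.+1 x z ->
  agree k (set_factor x j b) (set_factor z j b).
Proof.
move=> jk xz i; rewrite leq_eqVlt => /orP[/eqP ki|ki].
  by rewrite (_ : i = j) ?set_factor_at //; apply: val_inj; rewrite /= -ki.
have ij : i != j by rewrite -val_eqE /= jk gtn_eqF.
by rewrite !set_factor_ne // xz.
Qed.

Lemma vanishing_set k j z psi : j = k :> nat ->
  vanishing k.+1 z psi <-> forall b, vanishing k (set_factor z j b) psi.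
Proof.
move=> jk; split=> [h b x xz | h x xz].
  apply: h => i ki; rewrite xz ?set_factor_ne ?(ltnW ki) //.
  by rewrite -val_eqE /= jk gtn_eqF.
by rewrite -(set_factor_id x j); apply: (h (x j)); apply: agree_set.
Qed.

Lemma concentrated_set k j z psi : j = k :> nat ->
  concentrated k.+1 z psi <->
  concentrated k (set_factor z j o) psi /\
  forall b, b != o -> vanishing k (set_factor z j b) psi.
Proof.
move=> jk.
have agS x b : agree k x (set_factor z j b) -> agree k.+1 x z.
  move=> xz i ki; rewrite xz ?set_factor_ne ?(ltnW ki) //.
  by rewrite -val_eqE /= jk gtn_eqF.
split=> [h|[h0 h1] x xz].
  split=> [x xz [i ik io]|b bo x xz]; apply: h; rewrite ?(agS _ _ xz) //.
  - exact: agS xz.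
  - by exists i; rewrite // ltnW.
  - exact: agS xz.
  - by exists j; rewrite ?jk // xz ?jk // set_factor_at.
have xE := set_factor_id x j; have xa := agree_set (x j) jk xz; rewrite xE in xa.
have [xo|xo] := eqVneq (x j) o; last by move=> _; apply: h1 xo _ xa.
move=> [i ]; rewrite ltnS leq_eqVlt => /orP[/eqP ik|ik] io.
  have ij : i = j by apply: val_inj; rewrite /= ik jk.
  by rewrite ij xo eqxx in io.
by apply: h0; [rewrite -xo | exists i].
Qed.

Lemma kit_opt ctl j (v : 'cV[C]_d) : ctl_above j.+1 ctl ->
  exists (V : 'M[C]_d) (la : C), [/\ V \is unitarymx, V *m (la *: delta_mx o 0) = v
    & realizes g (K * isSome ctl) (fiber_op j (fun x => if active ctl x then V else 1%:M))].
Proof.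
case: ctl => [[i a]|] /= ji.
  have [|V [la [VU Vv r]]] := kit a o v (_ : i != j); first by rewrite -val_eqE /= gtn_eqF.
  by exists V, la; rewrite muln1.
have [V [la [VU Vv]]] := unitary_preparation o v.
by exists V, la; rewrite muln0; split=> //; apply: realizes_single.
Qed.

(** With its [d] subslices concentrated, the slice of [y] is supported on a single fiber in
    direction [j]. If [V] prepares the vector on that fiber from [la|o>], then [V^*] concentrates
    the slice. *)
Lemma fiber_step k j ctl y psi : j = k :> nat -> ctl_above k.+1 ctl -> active ctl y ->
  (forall b, concentrated k (set_factor y j b) psi) ->
  exists phi, [/\ reduces (isSome ctl) psi phi, concentrated k.+1 y phi
    & preserves k.+1 ctl psi phi].
Proof.
move=> jk ctlk acty yconc.
pose y0 : word d n := [ffun i : 'I_n => if (i < k)%N then o else y i].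
pose v : 'cV[C]_d := \col_b psi (set_factor y0 j b).
have [|V [la [VU Vv r]]] := @kit_opt ctl j v; first by rewrite jk.
pose M (W : 'M[C]_d) x := if active ctl x then W else 1%:M.
have Mj W : fiber_const j (M W).
  move=> x a; rewrite /M (@active_agree k.+1 _ _ x) // => i ki.
  by rewrite set_factor_ne // -val_eqE /= jk gtn_eqF.
have VtU : V^t* \is unitarymx by rewrite trmxC_unitary.
have VVt : V^t* *m V = 1%:M by have /unitarymxP := VtU; rewrite trmxCK.
pose phi := fiber_op j (M (V^t* )) psi.
have phi_act x : active ctl x -> phi x = \sum_b (V^t* ) (x j) b * psi (set_factor x j b).
  by rewrite fiber_opE /M => ->.
have phi_inact x : ~~ active ctl x -> phi x = psi x.
  move=> ax; rewrite fiber_opE /M (negPf ax).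
  rewrite (bigD1 (x j)) //= big1 => [|b bx].
    by rewrite mxE eqxx mul1r addr0 set_factor_id.
  by rewrite mxE eq_sym (negPf bx) mul0r.
exists phi; split.
- split.
    exists (fiber_op j (M V)) => //.
    rewrite fiber_opM // -[RHS](fiber_op1 j); apply: eq_fiber_op => x.
    by rewrite /M; case: ifP; rewrite ?mulmx1 ?(unitarymxP VU).
  apply: fiber_op_norm => // [|x]; first exact: leq_ltn_trans (leq0n o) (ltn_ord o).
  by rewrite /M; case: ifP; rewrite // unitarymx1.
- move=> x xy xo; rewrite phi_act; last by rewrite (active_agree ctlk xy).
  (* A letter other than [o] below [k] kills every term by [yconc]. Otherwise [x] lies on the fiber
     of [y0] with [x j] different from [o], where [V^* v], a multiple of [|o>], is zero. *)
  have [/existsP[i /andP[ik io]]|/existsPn none] :=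
    boolP [exists i : 'I_n, (i < k)%N && (x i != o)].
    rewrite big1 // => b _; rewrite (yconc b) ?mulr0 //; first exact: agree_set.
    by exists i; rewrite // set_factor_ne // -val_eqE /= jk ltn_eqF.
  have xjo : x j != o.
    have [i ] := xo; rewrite ltnS leq_eqVlt => /orP[/eqP ik|ik] io.
      by rewrite (_ : j = i) //; apply: val_inj; rewrite /= ik jk.
    by have := none i; rewrite ik io.
  transitivity ((V^t* *m v) (x j) 0).
    rewrite mxE; apply: eq_bigr => b _; rewrite [v _ _]mxE; congr (_ * psi _).
    apply/ffunP=> i; rewrite !ffunE; case: eqP => // ij; case: ltnP => [ik|ki].
      by have := none i; rewrite ik /= negbK => /eqP.
    rewrite xy // ltn_neqAle ki andbT; apply/eqP => ki'.
    by apply: ij; apply: val_inj; rewrite /= jk.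
  by rewrite -Vv mulmxA VVt mul1mx !mxE (negPf xjo) mulr0.
move=> z; split=> [az zc x xz xo|zv x xz].
  by rewrite phi_inact ?zc // (active_agree ctlk xz).
have [ax|ax] := boolP (active ctl x); last by rewrite phi_inact ?zv.
rewrite phi_act // big1 // => b _; rewrite zv ?mulr0 // => i ki.
by rewrite set_factor_ne ?xz // -val_eqE /= jk gtn_eqF.
Qed.

Fixpoint free_cost k : nat :=
  if k is k'.+1 then free_cost k' + d.-1 * (free_cost k' + k') else 0.

(** Without outer control, a reduction of [k] letters has [k] free merges, one per level; an outer
    control makes each of them a controlled gate. *)
Definition cost k ctl : nat := free_cost k + (if ctl is Some _ then k else 0).

Definition reducible k := forall ctl psi y, ctl_above k ctl -> active ctl y ->
  exists phi, [/\ reduces (cost k ctl) psi phi, concentrated k y phi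
    & preserves k ctl psi phi].

(** Once the slice of a letter is concentrated, the controls on other letters are inactive there, so
    later rounds keep it. The disjunction carries along the letter [o], reduced beforehand. *)
Lemma reducible_letters k j y psi (s : seq 'I_d) : j = k :> nat -> reducible k ->
  exists phi, [/\ reduces (size s * (free_cost k + k)) psi phi,
    forall a, a \in s \/ concentrated k (set_factor y j a) psi ->
      concentrated k (set_factor y j a) phi
    & forall z, (z j \notin s -> concentrated k z psi -> concentrated k z phi) /\
      (vanishing k z psi -> vanishing k z phi)].
Proof.
move=> jk Hk; elim: s psi => [|b s IH] psi.
  by exists psi; split=> [|a []|] //; apply: reduces_refl.
have [||phi1 [r1 c1 p1]] := Hk (Some (j, b)) psi (set_factor y j b).
- by rewrite /= jk.
- by rewrite /= set_factor_at.
have [phi [r c p]] := IH phi1; exists phi; split.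
- by rewrite /= mulSn; apply: reduces_trans r1 r.
- move=> a; rewrite inE => ha; apply: c; have [->|ab] := eqVneq a b; first by right.
  case: ha => [/orP[/eqP ab'|]|ca]; [by rewrite ab' eqxx in ab|by left|right].
  by apply: (p1 _).1 => //=; rewrite set_factor_at.
move=> z; split=> [|zv]; last by apply: (p z).2; apply: (p1 z).2.
by rewrite inE negb_or => /andP[zb zs] zc; apply: (p z).1 => //; apply: (p1 z).1.
Qed.

Lemma all_reducible k : (k <= n)%N -> reducible k.
Proof.
elim: k => [_|k IH kn] ctl psi y ctlk acty.
  exists psi; split=> [|x _ [i ]|z] //; rewrite /cost; case: ctl {ctlk acty} => [_|] /=;
  exact: reduces_refl.
have Hk := IH (ltnW kn); pose j := Ordinal kn; have jk : j = k :> nat by [].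
have ctlk' : ctl_above k ctl by case: (ctl) ctlk => [[i a]|] //= /ltnW.
have act_set z b : active ctl (set_factor z j b) = active ctl z.
  apply: active_agree ctlk _ => i ki.
  by rewrite set_factor_ne // -val_eqE /= gtn_eqF.
(* Only the letter [o] is reduced under [ctl]; each other letter [b] uses [(j, b)] instead of [ctl],
   so controls never accumulate. *)
have [|phi1 [r1 c1 p1]] := Hk ctl psi (set_factor y j o) ctlk'; first by rewrite act_set.
have [phi2 [r2 c2 p2]] := reducible_letters y phi1 (enum (predC1 o)) jk Hk.
have [b|phi [r c p]] := @fiber_step k j ctl y phi2 jk ctlk acty.
  apply: c2; rewrite mem_enum inE; have [->|bo] := eqVneq b o; [by right|by left].
exists phi; split=> //.
  have := reduces_trans (reduces_trans r1 r2) r.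
  rewrite -cardE cardC1 card_ord /cost /=; congr (reduces _ _ _).
  by case: (ctl) => [_|] /=; case: (d) o => [[]//|d' _] /=; lia.
(* If [ctl] is inactive, no control used is active on the subslice with letter [o], which stays
   concentrated; the other subslices may be acted on, but they vanish. *)
move=> z; split=> [az /(concentrated_set z _ jk)[zc zv]|/(vanishing_set z _ jk) zv].
  apply: (p z).1 => //; apply/(concentrated_set z _ jk); split=> [|b bo].
    apply: (p2 _).1; first by rewrite set_factor_at mem_enum inE eqxx.
    by apply: (p1 _).1 => //; rewrite act_set.
  by apply: (p2 _).2; apply: (p1 _).2; apply: zv.
apply: (p z).2; apply/(vanishing_set z _ jk) => b.
by apply: (p2 _).2; apply: (p1 _).2; apply: zv.
Qed.

Lemma state_preparation psi : (0 < n)%N -> is_state psi ->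
  exists c : seq (gate C d n), [/\ all (fun h => g h || is_single h) c,
    run c (ket C [ffun=> o]) = psi & (count g c <= K * free_cost n)%N].
Proof.
move=> n0 psi1; have [//|//|phi [[[op [c [cg cK cr]] e] nm] conc _]] :=
  @all_reducible n (leqnn n) None psi [ffun=> o].
set x0 : word d n := [ffun=> o]; pose la := phi x0.
(* At [k = n] the slice consists of all words, so concentration leaves one basis vector. *)
have phiE : phi = la *: ket C x0.
  apply/ffunP=> x; rewrite !ffunE /=; have [->|xx0] := eqVneq x x0.
    by rewrite /GRing.scale /= mulr1.
  rewrite scaler0; have [/existsP[i xi]|/existsPn xo] := boolP [exists i, x i != o].
    by apply: conc => [i'|]; [rewrite leqNgt ltn_ord | exists i].
  case/eqP: xx0; apply/ffunP=> i; rewrite ffunE; apply/eqP.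
  by rewrite -[_ == _]negbK.
have la1 : `|la| = 1.
  move: nm; rewrite psi1 (bigD1 x0) //= big1 => [|x xx0]; last first.
    by rewrite phiE !ffunE (negPf xx0) scaler0 normr0 expr0n.
  by rewrite addr0 => /eqP; rewrite pexpr_eq1 // => /eqP.
(* The leftover phase [la] comes from a scalar single-qudit gate, which is not counted. *)
pose h := Single (Ordinal n0) (la *: 1%:M : 'M[C]_d).
have lU : la *: 1%:M \is @unitarymx C d d by rewrite scalar_unitary // unitarymx1.
have hk : gate_op h (ket C x0) = phi.
  rewrite phiE run_Single -[in RHS](fiber_op1 (Ordinal n0) (ket C x0)).
  apply/ffunP=> x; rewrite !ffunE /GRing.scale /= mulr_sumr; apply: eq_bigr => a _.
  by rewrite mxE mulrA.
exists (h :: c); split=> /=.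
- by rewrite lU orbT.
- by rewrite -e -cr -hk.
have /negPf -> : ~~ g h by apply/negP => /gS; rewrite /= lU.
by move: cK; rewrite /cost addn0.
Qed.

End Reduction.

(** * Closed form of the count and the two bounds *)

Lemma free_cost_rat d n : (2 <= d)%N ->
  (free_cost d n)%:R = (d%:R ^+ n - 1) / (d%:R - 1) - n%:R :> rat.
Proof.
move=> d2; have d1 : d%:R - 1 != 0 :> rat by rewrite subr_eq0 pnatr_eq1 gtn_eqF.
elim: n => [|n IH]; first by rewrite expr0 subrr mul0r subrr.
rewrite /= !(natrD, natrM) IH -subn1 natrB 1?ltnW // exprS -[n.+1]addn1 natrD.
by field.
Qed.

Local Open Scope complex_scope.

Theorem theoremV1 (R : realType) (d n : nat) (hd : (2 <= d)%N) (hn : (1 <= n)%N)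
    (psi : qvec R[i] d n) (hpsi : is_state psi) :
  let ket0 : qvec R[i] d n := ket R[i] [ffun=> Ordinal (ltnW hd)] in
  (exists c : seq (gate R[i] d n),
    [/\ all (fun g => is_CINC g || is_single g) c,
        run c ket0 = psi
      & (count (@is_CINC R[i] d n) c)%:R
          <= 2 * ((d%:R ^+ n - 1) / (d%:R - 1) - n%:R) :> rat])
  /\
  (prime d ->
   exists c : seq (gate R[i] d n),
    [/\ all (fun g => is_SUM g || is_single g) c,
        run c ket0 = psi
      & (count (@is_SUM R[i] d n) c)%:R
          <= d%:R * ((d%:R ^+ n - 1) / (d%:R - 1) - n%:R) :> rat]).
Proof.
move=> ket0; rewrite -free_cost_rat //; split=> [|pd].
  have [c [cg cr cK]] := state_preparation (Ordinal (ltnW hd))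
    (@CINC_entangler _ d n) (CINC_kit hd) hn hpsi.
  (* The kit spends one CINC per controlled gate, so the count is within half of the stated
     bound. *)
  exists c; split=> //; rewrite -natrM ler_nat (leq_trans cK) // leq_mul2r orbT //.
have [c [cg cr cK]] := state_preparation (Ordinal (ltnW hd))
  (@SUM_entangler _ d n) (SUM_kit pd) hn hpsi.
by exists c; split=> //; rewrite -natrM ler_nat.
Qed.
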